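(* The algebra $\mathcal{A}_1$ is not of finite representation type.
   Context: $\Bbbk$ is an algebraically closed field of characteristic zero. $\mathcal{A}_1$ is the 72-dimensional $\Bbbk$-algebra generated by $H_t$ ($t\in\mathbb{S}_3$) and $a_{12},a_{13},a_{23}$ (indexed by the transpositions of $\mathbb{S}_3$; $H_{12}=H_{(12)}$, etc.), with relations $H_e=1$, $H_tH_s=H_{ts}$; $H_ta_i=\operatorname{sgn}(t)a_{tit^{-1}}H_t$; $a_{12}^2=0$; $a_{12}a_{23}+a_{23}a_{13}+a_{13}a_{12}=1-H_{12}H_{23}$. *)

(* Defs.v *)
From HB Require Import structures.
From mathcomp Require Import all_boot all_order all_algebra all_fingroup.
From mathcomp Require Import boolp.

Set Implicit Arguments.
Unset Strict Implicit.
Unset Printing Implicit Defensive.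

Import GRing.Theory.
Local Open Scope ring_scope.
Local Open Scope quotient_scope.

(* Associative unital k-algebras given by generators and relations: the       *)
(* quotient of the algebra expressions over the generators by the least       *)
(* congruence containing the relations and the axioms of k-algebras, i.e.     *)
(* the free algebra modulo the two-sided ideal generated by the relations.    *)

Inductive aterm (k : fieldType) (G : Type) : Type :=
| TGen of G
| TZero
| TOne
| TAdd of aterm k G & aterm k G
| TMul of aterm k G & aterm k G
| TScale of k & aterm k G.
Arguments TGen {k G} _.
Arguments TZero {k G}.
Arguments TOne {k G}.

HB.instance Definition _ k G := gen_eqMixin (aterm k G).
HB.instance Definition _ k G := gen_choiceMixin (aterm k G).

Section Presentation.
Variables (k : fieldType) (G : Type) (R : aterm k G -> aterm k G -> Prop).
Local Notation repr := generic_quotient.repr.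
Implicit Types (x y z : aterm k G) (c d : k).

Inductive pres_eq : aterm k G -> aterm k G -> Prop :=
| PE_rel x y : R x y -> pres_eq x y
| PE_refl x : pres_eq x x
| PE_sym x y : pres_eq x y -> pres_eq y x
| PE_trans x y z : pres_eq x y -> pres_eq y z -> pres_eq x z
| PE_Add x x' y y' :
    pres_eq x x' -> pres_eq y y' -> pres_eq (TAdd x y) (TAdd x' y')
| PE_Mul x x' y y' :
    pres_eq x x' -> pres_eq y y' -> pres_eq (TMul x y) (TMul x' y')
| PE_Scale c x x' : pres_eq x x' -> pres_eq (TScale c x) (TScale c x')
| PE_addA x y z : pres_eq (TAdd x (TAdd y z)) (TAdd (TAdd x y) z)
| PE_addC x y : pres_eq (TAdd x y) (TAdd y x)
| PE_add0 x : pres_eq (TAdd TZero x) x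
| PE_addN x : pres_eq (TAdd (TScale (-1) x) x) TZero
| PE_mulA x y z : pres_eq (TMul x (TMul y z)) (TMul (TMul x y) z)
| PE_mul1l x : pres_eq (TMul TOne x) x
| PE_mul1r x : pres_eq (TMul x TOne) x
| PE_mulDl x y z : pres_eq (TMul (TAdd x y) z) (TAdd (TMul x z) (TMul y z))
| PE_mulDr x y z : pres_eq (TMul x (TAdd y z)) (TAdd (TMul x y) (TMul x z))
| PE_scaleA c d x : pres_eq (TScale c (TScale d x)) (TScale (c * d) x)
| PE_scale1 x : pres_eq (TScale 1 x) x
| PE_scaleDr c x y : pres_eq (TScale c (TAdd x y)) (TAdd (TScale c x) (TScale c y))
| PE_scaleDl c d x : pres_eq (TScale (c + d) x) (TAdd (TScale c x) (TScale d x))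
| PE_scaleAl c x y : pres_eq (TScale c (TMul x y)) (TMul (TScale c x) y)
| PE_scaleAr c x y : pres_eq (TScale c (TMul x y)) (TMul x (TScale c y)).

Definition pres_eqb : ssrbool.rel (aterm k G) := fun x y => `[< pres_eq x y >].

Lemma pres_eqb_refl : reflexive pres_eqb.
Proof. by move=> x; apply/asboolP; apply: PE_refl. Qed.

Lemma pres_eqb_sym : symmetric pres_eqb.
Proof. by move=> x y; apply/asboolP/asboolP; apply: PE_sym. Qed.

Lemma pres_eqb_trans : transitive pres_eqb.
Proof.
by move=> y x z /asboolP xy /asboolP yz; apply/asboolP; apply: PE_trans xy yz.
Qed.

Canonical pres_equiv := EquivRel pres_eqb pres_eqb_refl pres_eqb_sym pres_eqb_trans.

Definition presented : Type := {eq_quot pres_equiv}.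
HB.instance Definition _ := Choice.on presented.
HB.instance Definition _ := Quotient.on presented.

Definition pres_of (x : aterm k G) : presented := \pi_presented x.

Lemma pres_ofP x y : pres_of x = pres_of y <-> pres_eq x y.
Proof.
split=> [/eqquotP/asboolP //|xy].
by apply/eqquotP/asboolP.
Qed.

Lemma pres_ofW (P : presented -> Prop) : (forall x, P (pres_of x)) -> forall u, P u.
Proof. by move=> H; elim/quotW. Qed.

Lemma repr_pres_of x : pres_eq (repr (pres_of x)) x.
Proof. by apply/pres_ofP; rewrite /pres_of reprK. Qed.

Definition pres_zero := pres_of TZero.
Definition pres_one := pres_of TOne.
Definition pres_add (u v : presented) := pres_of (TAdd (repr u) (repr v)).
Definition pres_mul (u v : presented) := pres_of (TMul (repr u) (repr v)).
Definition pres_scale c (u : presented) := pres_of (TScale c (repr u)).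
Definition pres_opp (u : presented) := pres_scale (-1) u.

Lemma pres_ofD x y : pres_add (pres_of x) (pres_of y) = pres_of (TAdd x y).
Proof. by apply/pres_ofP; apply: PE_Add; apply: repr_pres_of. Qed.

Lemma pres_ofM x y : pres_mul (pres_of x) (pres_of y) = pres_of (TMul x y).
Proof. by apply/pres_ofP; apply: PE_Mul; apply: repr_pres_of. Qed.

Lemma pres_ofZ c x : pres_scale c (pres_of x) = pres_of (TScale c x).
Proof. by apply/pres_ofP; apply: PE_Scale; apply: repr_pres_of. Qed.

Let E := (pres_ofD, pres_ofM, pres_ofZ).

Fact pres_addA : associative pres_add.
Proof.
elim/pres_ofW=> x; elim/pres_ofW=> y; elim/pres_ofW=> z.
by rewrite !E; apply/pres_ofP; constructor.
Qed.

Fact pres_addC : commutative pres_add.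
Proof.
elim/pres_ofW=> x; elim/pres_ofW=> y.
by rewrite !E; apply/pres_ofP; apply: PE_addC.
Qed.

Fact pres_add0 : left_id pres_zero pres_add.
Proof. by elim/pres_ofW=> x; rewrite !E; apply/pres_ofP; constructor. Qed.

Fact pres_addN : left_inverse pres_zero pres_opp pres_add.
Proof.
by elim/pres_ofW=> x; rewrite /pres_opp !E; apply/pres_ofP; constructor.
Qed.

HB.instance Definition _ :=
  GRing.isZmodule.Build presented pres_addA pres_addC pres_add0 pres_addN.

Fact pres_mulA : associative pres_mul.
Proof.
elim/pres_ofW=> x; elim/pres_ofW=> y; elim/pres_ofW=> z.
by rewrite !E; apply/pres_ofP; apply: PE_mulA.
Qed.

Fact pres_mul1l : left_id pres_one pres_mul.
Proof. by elim/pres_ofW=> x; rewrite !E; apply/pres_ofP; apply: PE_mul1l. Qed.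

Fact pres_mul1r : right_id pres_one pres_mul.
Proof. by elim/pres_ofW=> x; rewrite !E; apply/pres_ofP; apply: PE_mul1r. Qed.

Fact pres_mulDl : left_distributive pres_mul pres_add.
Proof.
elim/pres_ofW=> x; elim/pres_ofW=> y; elim/pres_ofW=> z.
by rewrite !E; apply/pres_ofP; apply: PE_mulDl.
Qed.

Fact pres_mulDr : right_distributive pres_mul pres_add.
Proof.
elim/pres_ofW=> x; elim/pres_ofW=> y; elim/pres_ofW=> z.
by rewrite !E; apply/pres_ofP; apply: PE_mulDr.
Qed.

HB.instance Definition _ := GRing.Zmodule_isPzRing.Build presented
  pres_mulA pres_mul1l pres_mul1r pres_mulDl pres_mulDr.

Fact pres_scaleA c d (u : presented) :
  pres_scale c (pres_scale d u) = pres_scale (c * d) u.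
Proof.
by elim/pres_ofW: u => x; rewrite !E; apply/pres_ofP; apply: PE_scaleA.
Qed.

Fact pres_scale1 : left_id 1 pres_scale.
Proof. by elim/pres_ofW=> x; rewrite !E; apply/pres_ofP; apply: PE_scale1. Qed.

Fact pres_scaleDr : right_distributive pres_scale pres_add.
Proof.
move=> c; elim/pres_ofW=> x; elim/pres_ofW=> y.
by rewrite !E; apply/pres_ofP; apply: PE_scaleDr.
Qed.

Fact pres_scaleDl (u : presented) : {morph pres_scale^~ u : c d / c + d >-> pres_add c d}.
Proof.
elim/pres_ofW: u => x c d.
by rewrite !E; apply/pres_ofP; apply: PE_scaleDl.
Qed.

HB.instance Definition _ := GRing.Zmodule_isLmodule.Build k presented
  pres_scaleA pres_scale1 pres_scaleDr pres_scaleDl.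

Fact pres_scaleAl c (u v : presented) :
  pres_scale c (pres_mul u v) = pres_mul (pres_scale c u) v.
Proof.
elim/pres_ofW: u => x; elim/pres_ofW: v => y.
by rewrite !E; apply/pres_ofP; apply: PE_scaleAl.
Qed.

Fact pres_scaleAr c (u v : presented) :
  pres_scale c (pres_mul u v) = pres_mul u (pres_scale c v).
Proof.
elim/pres_ofW: u => x; elim/pres_ofW: v => y.
by rewrite !E; apply/pres_ofP; apply: PE_scaleAr.
Qed.

Fixpoint aterm_eval (B : algType k) (g : G -> B) (x : aterm k G) : B :=
  match x with
  | TGen i => g i
  | TZero => 0
  | TOne => 1
  | TAdd x y => aterm_eval g x + aterm_eval g y
  | TMul x y => aterm_eval g x * aterm_eval g y
  | TScale c x => c *: aterm_eval g x
  end.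

Lemma aterm_eval_pres (B : algType k) (g : G -> B) :
  (forall x y, R x y -> aterm_eval g x = aterm_eval g y) ->
  forall x y, pres_eq x y -> aterm_eval g x = aterm_eval g y.
Proof.
move=> gR x y; elim=> {x y} //=.
- by move=> x y z _ -> _ ->.
- by move=> x x' y y' _ -> _ ->.
- by move=> x x' y y' _ -> _ ->.
- by move=> c x x' _ ->.
- by move=> x y z; rewrite addrA.
- by move=> x y; rewrite addrC.
- by move=> x; rewrite add0r.
- by move=> x; rewrite scaleN1r addNr.
- by move=> x y z; rewrite mulrA.
- by move=> x; rewrite mul1r.
- by move=> x; rewrite mulr1.
- by move=> x y z; rewrite mulrDl.
- by move=> x y z; rewrite mulrDr.
- by move=> c d x; rewrite scalerA.
- by move=> x; rewrite scale1r.
- by move=> c x y; rewrite scalerDr.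
- by move=> c d x; rewrite scalerDl.
- by move=> c x y; rewrite scalerAl.
- by move=> c x y; rewrite scalerAr.
Qed.

End Presentation.


Definition is_transposition (t : 'S_3) : bool :=
  [exists i, exists j, (i != j) && (t == tperm i j)].

Definition transposition : Type := {t : 'S_3 | is_transposition t}.

Fact tperm_is_transposition (i j : 'I_3) :
  i != j -> is_transposition (tperm i j).
Proof.
by move=> ij; apply/existsP; exists i; apply/existsP; exists j; rewrite ij eqxx.
Qed.

Definition transp (i j : 'I_3) (ij : i != j) : transposition :=
  exist _ (tperm i j) (tperm_is_transposition ij).

(* The letters 1, 2, 3 are the elements 0, 1, 2 of 'I_3.                      *)
Definition letter1 : 'I_3 := @Ordinal 3 0 isT.
Definition letter2 : 'I_3 := @Ordinal 3 1 isT.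
Definition letter3 : 'I_3 := @Ordinal 3 2 isT.

Definition tau12 : transposition := @transp letter1 letter2 isT.
Definition tau13 : transposition := @transp letter1 letter3 isT.
Definition tau23 : transposition := @transp letter2 letter3 isT.

Inductive A1_gen : Type :=
| GenH of 'S_3
| GenA of transposition.

(* Products in 'S_3 are those of the library, (s * t) x = t (s x). Inversion  *)
(* is an isomorphism onto the group with the opposite product that fixes the  *)
(* transpositions, so either convention gives the same algebra up to the      *)
(* relabelling H_t -> H_(t^-1).                                               *)
Section A1Relations.
Variable k : fieldType.
Local Notation "''H_' t" := (@TGen k A1_gen (GenH t)) (at level 8, t at level 2).
Local Notation "''a_' i" := (@TGen k A1_gen (GenA i)) (at level 8, i at level 2).
Local Notation "x ** y" := (TMul x y) (at level 40, left associativity).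
Local Notation "x ++ y" := (TAdd x y).

Inductive A1_rel : aterm k A1_gen -> aterm k A1_gen -> Prop :=
| A1_rel_H1 : A1_rel 'H_(1%g) TOne
| A1_rel_HM (t s : 'S_3) : A1_rel ('H_t ** 'H_s) 'H_((t * s)%g)
| A1_rel_Ha (t : 'S_3) (i j : transposition) :
    val j = (t * val i * t^-1)%g ->
    A1_rel ('H_t ** 'a_i) (TScale ((-1) ^+ odd_perm t) ('a_j ** 'H_t))
| A1_rel_a12 : A1_rel ('a_tau12 ** 'a_tau12) TZero
| A1_rel_aa :
    A1_rel (('a_tau12 ** 'a_tau23 ++ 'a_tau23 ** 'a_tau13) ++ 'a_tau13 ** 'a_tau12)
           (TOne ++ TScale (-1) ('H_(val tau12) ** 'H_(val tau23))).

End A1Relations.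

Definition A1 (k : fieldType) : Type := presented (@A1_rel k).

Section A1Algebra.
Variable k : fieldType.

HB.instance Definition _ := GRing.PzRing.on (A1 k).
HB.instance Definition _ := GRing.Lmodule.on (A1 k).

Let triv (g : A1_gen) : k^o := if g is GenH _ then 1 else 0.

Fact A1_oner_neq0 : (1 : A1 k) != 0.
Proof.
apply/eqP => /pres_ofP e.
have /eqP : aterm_eval triv TOne = aterm_eval triv TZero.
  apply: aterm_eval_pres e => _ _ [] //=.
  - by move=> *; rewrite mulr1.
  - by move=> t i j _; rewrite mulr0 mul0r scaler0.
  - by rewrite mulr0.
  - by rewrite !mulr0 !addr0 mulr1 scaleN1r subrr.
by rewrite oner_eq0.
Qed.

HB.instance Definition _ := GRing.PzSemiRing_isNonZero.Build (A1 k) A1_oner_neq0.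
HB.instance Definition _ :=
  GRing.Lmodule_isLalgebra.Build k (A1 k) (@pres_scaleAl _ _ (@A1_rel k)).
HB.instance Definition _ :=
  GRing.Lalgebra_isAlgebra.Build k (A1 k) (@pres_scaleAr _ _ (@A1_rel k)).

Definition A1_H (t : 'S_3) : A1 k := pres_of _ (TGen (GenH t)).
Definition A1_a (i : transposition) : A1 k := pres_of _ (TGen (GenA i)).

Lemma A1_aterm_eval (x : aterm k A1_gen) :
  aterm_eval (fun g => pres_of (@A1_rel k) (TGen g) : A1 k) x = pres_of _ x.
Proof.
elim: x => //= [x -> y ->|x -> y ->|c x ->].
- exact: pres_ofD.
- exact: pres_ofM.
- exact: pres_ofZ.
Qed.

Lemma A1_relP (x y : aterm k A1_gen) : A1_rel x y ->
  aterm_eval (fun g => pres_of (@A1_rel k) (TGen g) : A1 k) x =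
  aterm_eval (fun g => pres_of (@A1_rel k) (TGen g) : A1 k) y.
Proof. by move=> xy; rewrite !A1_aterm_eval; apply/pres_ofP/PE_rel. Qed.

Lemma A1_relations :
  [/\ A1_H 1%g = 1,
      forall t s, A1_H t * A1_H s = A1_H (t * s)%g,
      forall t i j, val j = (t * val i * t^-1)%g ->
        A1_H t * A1_a i = (-1) ^+ odd_perm t *: (A1_a j * A1_H t),
      A1_a tau12 * A1_a tau12 = 0
    & A1_a tau12 * A1_a tau23 + A1_a tau23 * A1_a tau13 + A1_a tau13 * A1_a tau12
      = 1 - A1_H (val tau12) * A1_H (val tau23)].
Proof.
split; last by rewrite -scaleN1r; exact: (A1_relP (A1_rel_aa k)).
- exact: (A1_relP (A1_rel_H1 k)).
- by move=> t s; exact: (A1_relP (A1_rel_HM k t s)).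
- by move=> t i j ij; exact: (A1_relP (A1_rel_Ha k ij)).
- exact: (A1_relP (A1_rel_a12 k)).
Qed.

Lemma A1_lift (B : algType k) (H : 'S_3 -> B) (a : transposition -> B) :
  H 1%g = 1 -> (forall t s, H t * H s = H (t * s)%g) ->
  (forall t i j, val j = (t * val i * t^-1)%g ->
     H t * a i = (-1) ^+ odd_perm t *: (a j * H t)) ->
  a tau12 * a tau12 = 0 ->
  a tau12 * a tau23 + a tau23 * a tau13 + a tau13 * a tau12
    = 1 - H (val tau12) * H (val tau23) ->
  exists f : {lrmorphism A1 k -> B},
    (forall t, f (A1_H t) = H t) /\ (forall i, f (A1_a i) = a i).
Proof.
move=> H1 HM Ha a12 aa.
pose g x := match x with GenH t => H t | GenA i => a i end.
have gE x y : pres_eq (@A1_rel k) x y -> aterm_eval g x = aterm_eval g y.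
  apply: aterm_eval_pres => _ _ [] //=.
  by rewrite aa scaleN1r.
pose f (u : A1 k) : B := aterm_eval g (generic_quotient.repr u).
have fE x : f (pres_of _ x) = aterm_eval g x by apply/gE/repr_pres_of.
have fL : linear f.
  move=> c; elim/pres_ofW=> x; elim/pres_ofW=> y.
  rewrite [X in f X](_ : _ = pres_of _ (TAdd (TScale c x) y)) ?fE //=.
  by rewrite -pres_ofD -pres_ofZ.
have fM : monoid_morphism f.
  split; first exact: (fE TOne).
  elim/pres_ofW=> x; elim/pres_ofW=> y.
  by rewrite [X in f X](_ : _ = pres_of _ (TMul x y)) ?fE // -pres_ofM.
pose fl := GRing.isLinear.Build k (A1 k) B *:%R f fL.
pose fm := GRing.isMonoidMorphism.Build (A1 k) B f fM.
pose F : {lrmorphism A1 k -> B} := HB.pack f fl fm.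
by exists F; split=> x; apply: fE.
Qed.

End A1Algebra.

Section RepresentationType.
Variables (k : fieldType) (A : algType k).

(* k acts on an A-module V through c |-> c%:A, so V need not carry a second   *)
(* module structure (over k).                                                 *)
Definition finite_dimensional (V : lmodType A) : Prop :=
  exists (n : nat) (e : 'I_n -> V), forall v : V,
    exists c : 'I_n -> k, v = \sum_(i < n) (c i)%:A *: e i.

Definition indecomposable (V : lmodType A) : Prop :=
  (exists v : V, v != 0) /\
  (forall S T : {pred V}, submod_closed S -> submod_closed T ->
     (forall v, exists s t, [/\ s \in S, t \in T & v = s + t]) ->
     (forall v, v \in S -> v \in T -> v = 0) ->
     (forall v, v \in S -> v = 0) \/ (forall v, v \in T -> v = 0)).

Definition isomorphic (V W : lmodType A) : Prop :=
  exists f : {linear V -> W}, bijective f.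

Definition finite_representation_type : Prop :=
  exists (n : nat) (M : 'I_n -> lmodType A),
    (forall i, finite_dimensional (M i) /\ indecomposable (M i)) /\
    (forall V : lmodType A, finite_dimensional V -> indecomposable V ->
       exists i, isomorphic V (M i)).

End RepresentationType.

(* Main.v *)
(* For each scalar l there is a 6-dimensional module M_l = k^3 (+) sgn (x) k^3,
   with standard bases x_j and y_j permuted by S_3, on which the transposition
   with fixed letter m acts, with indices mod 3, by
     a_m x_j = d_m + (l + [j = m]) s + (1 - 3 [j = m]) y_m,
     a_m y_j = - 1/3 eps(m, j) (d_m + s),
   where d_m = x_(m+1) - x_(m+2), s = y_1 + y_2 + y_3 and eps(m, m + 1) = 1,
   eps(m, m + 2) = -1, eps(m, m) = 0. The vector u = x_1 + x_2 + x_3 generates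
   M_l and spans its S_3-invariants, so a submodule not killed by the projection
   onto the invariants is everything, and M_l is indecomposable. Two elements of
   the algebra independent of l send u to 9 s and to -3 (3 l + 1) s, so the
   annihilator of u, hence the isomorphism class of M_l, determines l. *)
Require Import Defs.
From HB Require Import structures.
From mathcomp Require Import all_boot all_order all_algebra all_fingroup.
From mathcomp Require Import ring.

Set Implicit Arguments.
Unset Strict Implicit.
Unset Printing Implicit Defensive.

Import GRing.Theory.
Local Open Scope ring_scope.

(** * Modules over an algebra given by matrix representations *)

Section MatrixModule.
Variables (k : fieldType) (A : algType k) (n : nat).

(** The alias keeps [f] in the type, so that column vectors can carry one [A]-module structure for
    each representation. *)
Definition mxmod (f : {lrmorphism A -> 'M[k]_n.+1}) : Type := 'cV[k]_n.+1.

Variable f : {lrmorphism A -> 'M[k]_n.+1}.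

HB.instance Definition _ := GRing.Zmodule.copy (mxmod f) 'cV[k]_n.+1.

Definition mxmod_scale (x : A) (v : mxmod f) : mxmod f := f x *m v.

Fact mxmod_scaleA x y v : mxmod_scale x (mxmod_scale y v) = mxmod_scale (x * y) v.
Proof. by rewrite /mxmod_scale rmorphM mulmxA. Qed.

Fact mxmod_scale1 : left_id 1 mxmod_scale.
Proof. by move=> v; rewrite /mxmod_scale rmorph1 mul1mx. Qed.

Fact mxmod_scaleDr : right_distributive mxmod_scale +%R.
Proof. by move=> x u v; rewrite /mxmod_scale mulmxDr. Qed.

Fact mxmod_scaleDl v : {morph mxmod_scale^~ v : x y / x + y}.
Proof. by move=> x y; rewrite /mxmod_scale rmorphD mulmxDl. Qed.

HB.instance Definition _ := GRing.Zmodule_isLmodule.Build A (mxmod f)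
  mxmod_scaleA mxmod_scale1 mxmod_scaleDr mxmod_scaleDl.

Lemma mxmodE (x : A) (v : mxmod f) : x *: v = f x *m v.
Proof. by []. Qed.

Lemma mxmod_scalarE (c : k) (v : mxmod f) : c%:A *: v = (c *: (v : 'cV_n.+1) : 'cV_n.+1).
Proof. by rewrite mxmodE linearZ /= rmorph1 -scalemxAl mul1mx. Qed.

Lemma mxmod_finite_dimensional : @finite_dimensional k A (mxmod f).
Proof.
exists n.+1, (fun i => delta_mx i 0 : 'cV_n.+1) => v.
exists (fun i => (v : 'cV_n.+1) i 0).
rewrite [LHS](matrix_sum_delta (v : 'cV_n.+1)).
apply: eq_bigr => i _.
by rewrite big_ord_recl big_ord0 addr0 mxmod_scalarE.
Qed.

End MatrixModule.

(** * Case analysis on three letters; natural numbers in characteristic zero *)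

Lemma ord3P (P : 'I_3 -> Prop) : P letter1 -> P letter2 -> P letter3 -> forall i, P i.
Proof.
move=> P0 P1 P2 [[|[|[|//]]] i_lt]; [move: P0|move: P1|move: P2];
  by congr P; apply: val_inj.
Qed.

Lemma natr_inj (k : fieldType) : (forall n, (n%:R == 0 :> k) = (n == 0)%N) ->
  injective (fun n => n%:R : k).
Proof.
move=> natr0; suff le m n : m%:R = n%:R :> k -> (n <= m)%N.
  by move=> m n /= mn; apply/eqP; rewrite eqn_leq !le.
case: (leqP n m) => // /[dup] lt_mn /ltnW le_mn mn.
by rewrite -subn_gt0 lt0n -natr0 natrB // mn subrr eqxx in lt_mn.
Qed.

(** * Vectors of [k^3] and how [S_3] moves them *)

Section Matrices.
Variable k : fieldType.

Definition all1 : 'cV[k]_3 := const_mx 1.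
Definition unit3 (m : 'I_3) : 'cV[k]_3 := delta_mx m 0.
(* Indices are added in 'I_3 = Z/3. *)
Definition eps (m j : 'I_3) : k := (j == m + 1)%:R - (m == j + 1)%:R.
Definition diff3 (m : 'I_3) : 'cV[k]_3 := \col_j eps m j.

(** [eps] is the cyclic orientation of a pair of letters, which a transposition reverses; the
    general case follows by writing [t] as a product of transpositions. *)
Lemma eps_perm (t : 'S_3) m j : eps (t m) (t j) = (-1) ^+ odd_perm t * eps m j.
Proof.
move: m j; case: (prod_tpermP t) => ts -> /=.
elim: ts => [|[a b] ts IH] /= => [_|/andP[ab /IH{}IH]] m j.
  by rewrite big_nil odd_perm1 !perm1 mul1r.
rewrite big_cons !permM IH odd_permM odd_tperm ab signr_addb expr1.
rewrite mulN1r mulNr -mulrN; congr (_ * _); rewrite /eps.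
move: ab; elim/ord3P: a; elim/ord3P: b => //= _; elim/ord3P: m; elim/ord3P: j;
  by rewrite ?(tpermL, tpermR, tpermD) //=; ring.
Qed.

Lemma perm_mx_all1 (t : 'S_3) : perm_mx t *m all1 = all1.
Proof.
by rewrite -row_permE; apply/matrixP => i j; rewrite !mxE.
Qed.

Lemma tr_all1_perm_mx (t : 'S_3) : all1^T *m perm_mx t = all1^T.
Proof.
by rewrite -[perm_mx t]trmxK -trmx_mul tr_perm_mx perm_mx_all1.
Qed.

Lemma perm_mx_unit3 (t : 'S_3) m : perm_mx t *m unit3 (t m) = unit3 m.
Proof.
by rewrite -row_permE; apply/matrixP => i j; rewrite !mxE (inj_eq perm_inj).
Qed.

Lemma tr_unit3_perm_mx (t : 'S_3) m : (unit3 m)^T *m perm_mx t = (unit3 (t m))^T.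
Proof.
rewrite -[perm_mx t]trmxK -trmx_mul tr_perm_mx.
by rewrite -{1}[m](permK t) perm_mx_unit3.
Qed.

Lemma perm_mx_diff3 (t : 'S_3) m :
  perm_mx t *m diff3 (t m) = (-1) ^+ odd_perm t *: diff3 m.
Proof.
by rewrite -row_permE; apply/matrixP => i j; rewrite !mxE eps_perm.
Qed.

Lemma tr_diff3_perm_mx (t : 'S_3) m :
  (diff3 m)^T *m perm_mx t = (-1) ^+ odd_perm t *: (diff3 (t m))^T.
Proof.
rewrite -[perm_mx t]trmxK -trmx_mul tr_perm_mx.
by rewrite -{1}[m](permK t) perm_mx_diff3 odd_permV linearZ.
Qed.

Definition Hmx (t : 'S_3) : 'M[k]_(3 + 3) :=
  block_mx (perm_mx t) 0 0 ((-1) ^+ odd_perm t *: perm_mx t).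

Lemma Hmx1 : Hmx 1 = 1%:M.
Proof. by rewrite /Hmx odd_perm1 scale1r perm_mx1 -scalar_mx_block. Qed.

Lemma HmxM t s : Hmx t *m Hmx s = Hmx (t * s)%g.
Proof.
rewrite /Hmx mulmx_block !(mul0mx, mulmx0) !addr0 add0r perm_mxM.
by rewrite -scalemxAl -scalemxAr scalerA odd_permM signr_addb.
Qed.

Lemma mul_tr_addl p (a b : 'cV[k]_3) (c : 'M[k]_(3, p)) (x : k) :
  (x *: a + b)^T *m c = x *: (a^T *m c) + b^T *m c.
Proof. by rewrite linearD /= linearZ /= mulmxDl -scalemxAl. Qed.

Lemma mul_tr_subr p (a b : 'cV[k]_3) (c : 'M[k]_(3, p)) (x : k) :
  (a - x *: b)^T *m c = a^T *m c - x *: (b^T *m c).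
Proof. by rewrite linearB /= linearZ /= mulmxBl -scalemxAl. Qed.

(** * The matrices [a_m] and the defining relations *)

Variable l : k.

Definition amx (m : 'I_3) : 'M[k]_(3 + 3) :=
  block_mx (diff3 m *m all1^T) (- 3^-1 *: (diff3 m *m (diff3 m)^T))
    (all1 *m (l *: all1 + unit3 m)^T + unit3 m *m (all1 - 3 *: unit3 m)^T)
    (- 3^-1 *: (all1 *m (diff3 m)^T)).

(** With the product of ['S_3], [t * i * t^-1] fixes [m] exactly when [i] fixes [t m], whence the
    index on the left. Every block collects the sign an odd number of times: once for each factor
    [diff3], once for each passage through the sign-twisted half of [Hmx]. *)
Lemma Hmx_amx t m :
  Hmx t *m amx (t m) = (-1) ^+ odd_perm t *: (amx m *m Hmx t).
Proof.
rewrite /Hmx /amx !mulmx_block !(mul0mx, mulmx0) !addr0 !add0r scale_block_mx.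
have sgnK (x : 'M[k]_3) : (-1) ^+ odd_perm t *: ((-1) ^+ odd_perm t *: x) = x.
  by rewrite scalerA -signr_addb addbb scale1r.
congr block_mx.
- by rewrite mulmxA perm_mx_diff3 -!mulmxA tr_all1_perm_mx -scalemxAl.
- rewrite -scalemxAr mulmxA perm_mx_diff3 -!scalemxAl -!scalemxAr -!mulmxA.
  by rewrite tr_diff3_perm_mx -!scalemxAr !sgnK scalerA mulrC -scalerA.
- rewrite -scalemxAl; congr (_ *: _).
  rewrite mulmxDr mulmxDl !mulmxA perm_mx_all1 perm_mx_unit3 -!mulmxA.
  congr (_ + _); congr (_ *m _).
    by rewrite mul_tr_addl tr_all1_perm_mx tr_unit3_perm_mx linearD /= linearZ.
  by rewrite mul_tr_subr tr_all1_perm_mx tr_unit3_perm_mx linearB /= linearZ.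
- rewrite -!scalemxAl -!scalemxAr mulmxA perm_mx_all1 -!mulmxA tr_diff3_perm_mx.
  by rewrite -!scalemxAr !sgnK scalerA mulrC -scalerA.
Qed.

Hypothesis three_neq0 : 3 != 0 :> k.

Lemma tr_diff3_all1 m : (diff3 m)^T *m all1 = 0.
Proof.
apply/matrixP => i j; rewrite !mxE !big_ord_recl big_ord0 !mxE /eps.
by elim/ord3P: m => /=; ring.
Qed.

Lemma tr_all1_diff3 m : all1^T *m diff3 m = 0.
Proof. by rewrite -[LHS]trmxK trmx_mul trmxK tr_diff3_all1 trmx0. Qed.

Lemma tr_diff3_unit3 m : (diff3 m)^T *m unit3 m = 0.
Proof.
apply/matrixP => i j; rewrite !mxE !big_ord_recl big_ord0 !mxE /eps.
by elim/ord3P: m; rewrite ord1 /=; ring.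
Qed.

Lemma tr_unit3_diff3 m : (unit3 m)^T *m diff3 m = 0.
Proof. by rewrite -[LHS]trmxK trmx_mul trmxK tr_diff3_unit3 trmx0. Qed.

(** The blocks of [amx] are sums of rank-one matrices, so their products reduce to scalar pairings
    of columns. *)
Lemma mul_outer (a b c d : 'cV[k]_3) (x : k) :
  b^T *m c = x%:M -> a *m b^T *m (c *m d^T) = x *: (a *m d^T).
Proof. by move=> bc; rewrite -mulmxA (mulmxA b^T) bc mul_scalar_mx -scalemxAr. Qed.

Lemma tr_diff3_unit3_next m : (diff3 m)^T *m unit3 (m + 1) = 1%:M.
Proof.
apply/matrixP => i j; rewrite !mxE !big_ord_recl big_ord0 !mxE /eps.
by elim/ord3P: m; rewrite !ord1 /=; ring.
Qed.

Lemma tr_unit3_diff3_next m : (unit3 m)^T *m diff3 (m + 1) = (-1)%:M.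
Proof.
apply/matrixP => i j; rewrite !mxE !big_ord_recl big_ord0 !mxE /eps.
by elim/ord3P: m; rewrite !ord1 /=; ring.
Qed.

Lemma amx_sqr m : amx m *m amx m = 0.
Proof.
have X0 : (l *: all1 + unit3 m)^T *m diff3 m = 0.
  by rewrite mul_tr_addl tr_all1_diff3 tr_unit3_diff3 scaler0 addr0.
have Y0 : (all1 - 3 *: unit3 m)^T *m diff3 m = 0.
  by rewrite mul_tr_subr tr_all1_diff3 tr_unit3_diff3 scaler0 subr0.
rewrite /amx mulmx_block -[RHS](@block_mx0 _ 3 3 3 3).
rewrite !mulmxDr !mulmxDl -!scalemxAl -!scalemxAr.
rewrite !(@mul_outer _ _ _ _ 0)
  ?(tr_all1_diff3, tr_diff3_all1, tr_diff3_unit3) ?raddf0 //.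
by rewrite !scale0r !scaler0 !addr0.
Qed.

(** The parameter [l] only multiplies [all1 *m all1^T], and [all1] is orthogonal to every [diff3],
    so [l] drops out. This is what leaves it free in the last relation. *)
Lemma amx_mul_next m : amx m *m amx (m + 1) =
  block_mx (- 3^-1 *: (diff3 m *m (all1 - 3 *: unit3 (m + 1))^T)) 0
    ((3 *: unit3 m - all1) *m all1^T - 3^-1 *: (all1 *m (all1 - 3 *: unit3 (m + 1))^T))
    (- 3^-1 *: ((3 *: unit3 m - all1) *m (diff3 (m + 1))^T)).
Proof.
have XD : (l *: all1 + unit3 m)^T *m diff3 (m + 1) = (-1)%:M.
  by rewrite mul_tr_addl tr_all1_diff3 tr_unit3_diff3_next scaler0 add0r.
have YD : (all1 - 3 *: unit3 m)^T *m diff3 (m + 1) = 3%:M.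
  rewrite mul_tr_subr tr_all1_diff3 tr_unit3_diff3_next.
  by rewrite sub0r scale_scalar_mx mulrN1 -raddfN opprK.
have D1 : (diff3 m)^T *m all1 = 0%:M by rewrite tr_diff3_all1 raddf0.
have I0 i : (all1)^T *m diff3 i = 0%:M by rewrite tr_all1_diff3 raddf0.
have DU := tr_diff3_unit3_next m.
rewrite /amx mulmx_block !mulmxDr !mulmxDl -!scalemxAl -!scalemxAr.
rewrite !(mul_outer _ _ D1) !(mul_outer _ _ DU) !(mul_outer _ _ (I0 _)).
rewrite !(mul_outer _ _ XD) !(mul_outer _ _ YD).
rewrite !(scale0r, scaler0, add0r, addr0, scale1r, scaleN1r) !mulNmx.
congr block_mx; first by rewrite scaleNr [- _ + _]addrC.
by rewrite -scalerDr addrC.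
Qed.

(** The transpositions (12), (23), (13) fix the letters 3, 1, 2, so each of the three products has
    the form [a_m a_(m+1)]. *)
Lemma amx_cycle :
  amx letter3 *m amx letter1 + amx letter1 *m amx letter2 + amx letter2 *m amx letter3
  = 1%:M - Hmx (tperm letter1 letter2 * tperm letter2 letter3)%g.
Proof.
have e2 : letter2 = letter1 + 1 by apply/val_inj.
have e3 : letter3 = letter2 + 1 by apply/val_inj.
have e1 : letter1 = letter3 + 1 by apply/val_inj.
rewrite [in X in X + _ + _]e1 [in X in _ + X + _]e2 [in X in _ + X]e3 !amx_mul_next.
rewrite -e1 -e2 -e3.
rewrite /Hmx !add_block_mx scalar_mx_block opp_block_mx add_block_mx.
rewrite odd_permM !odd_tperm /= scale1r.
have cyc i : (tperm letter1 letter2 * tperm letter2 letter3)%g i = i - 1.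
  by rewrite permM; elim/ord3P: i; rewrite !permE /=; apply: val_inj.
(* Only the action of the 3-cycle as [i - 1] is kept; the blocks are then compared entry by
   entry. *)
move: (_ * _)%g cyc => t cyc.
by congr block_mx; apply/matrixP => i j; rewrite !mxE ?big_ord1 ?mxE ?cyc /eps;
  elim/ord3P: i; elim/ord3P: j => /=; field.
Qed.

(* A transposition of three letters has a single fixed letter; summing over the
   fixed letters makes equivariance a mere reindexing. *)
Definition transp_mx (i : transposition) : 'M[k]_(3 + 3) :=
  \sum_(m | val i m == m) amx m.

Lemma Hmx_transp_mx t i j : val j = (t * val i * t^-1)%g ->
  Hmx t *m transp_mx i = (-1) ^+ odd_perm t *: (transp_mx j *m Hmx t).
Proof.
move=> ij; rewrite mulmx_suml mulmx_sumr scaler_sumr.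
rewrite (reindex_inj (@perm_inj _ t)) /=; apply: eq_big => [m|m _].
  by rewrite ij !permM (can2_eq (permKV t) (permK t)).
exact: Hmx_amx.
Qed.

Lemma transp_mx12 : transp_mx tau12 = amx letter3.
Proof. by apply: big_pred1; elim/ord3P; rewrite /= permE. Qed.

Lemma transp_mx13 : transp_mx tau13 = amx letter2.
Proof. by apply: big_pred1; elim/ord3P; rewrite /= permE. Qed.

Lemma transp_mx23 : transp_mx tau23 = amx letter1.
Proof. by apply: big_pred1; elim/ord3P; rewrite /= permE. Qed.

Lemma A1_rep_exists : exists f : {lrmorphism A1 k -> 'M[k]_6},
  (forall t, f (A1_H k t) = Hmx t) /\ (forall i, f (A1_a k i) = transp_mx i).
Proof.
apply: (@A1_lift k 'M[k]_6 Hmx transp_mx).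
- exact: Hmx1.
- exact: HmxM.
- exact: Hmx_transp_mx.
- by rewrite transp_mx12; apply: amx_sqr.
- rewrite transp_mx12 transp_mx13 transp_mx23.
  exact: (etrans amx_cycle (congr1 (fun x => 1%:M - x) (esym (HmxM _ _)))).
Qed.

(** * Action on the vectors [u], [d_m], [y_m] and [s] *)

Definition vX (x : 'cV[k]_3) : 'cV[k]_(3 + 3) := col_mx x 0.
Definition vY (y : 'cV[k]_3) : 'cV[k]_(3 + 3) := col_mx 0 y.

Fact vX_linear : linear vX.
Proof. by move=> c x y; rewrite /vX scale_col_mx add_col_mx scaler0 addr0. Qed.

Fact vY_linear : linear vY.
Proof. by move=> c x y; rewrite /vY scale_col_mx add_col_mx scaler0 addr0. Qed.

HB.instance Definition _ := GRing.isLinear.Build k _ _ _ vX vX_linear.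
HB.instance Definition _ := GRing.isLinear.Build k _ _ _ vY vY_linear.

Lemma amx_vX_all1 m : amx m *m vX all1 = 3 *: vX (diff3 m) + (3 * l + 1) *: vY all1.
Proof.
rewrite /amx /vX /vY mul_block_col !mulmx0 !addr0 !scale_col_mx !scaler0.
rewrite add_col_mx add0r addr0.
have I1 : all1^T *m all1 = 3%:M :> 'M[k]_1.
  by apply/matrixP => i j; rewrite !ord1 !mxE !big_ord_recl big_ord0 !mxE /=; ring.
have U1 : (unit3 m)^T *m all1 = 1%:M.
  apply/matrixP => i j; rewrite !ord1 !mxE !big_ord_recl big_ord0 !mxE /=.
  by elim/ord3P: m => /=; ring.
congr col_mx; first by rewrite -mulmxA I1 mul_mx_scalar.
rewrite mulmxDl -!mulmxA mul_tr_addl mul_tr_subr I1 U1.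
rewrite !scale_scalar_mx mulr1 -raddfB subrr raddf0 mulmx0 addr0 -raddfD /=.
by rewrite mul_mx_scalar mulrC.
Qed.

Lemma amx_vX_diff3 m : amx m *m vX (diff3 (m + 1)) = 3 *: vY (unit3 m) - vY all1.
Proof.
rewrite /amx /vX /vY mul_block_col !mulmx0 !addr0 !scale_col_mx !scaler0.
rewrite opp_col_mx add_col_mx oppr0 addr0 -mulmxA tr_all1_diff3 mulmx0.
rewrite mulmxDl -!mulmxA mul_tr_addl mul_tr_subr.
rewrite !tr_all1_diff3 !tr_unit3_diff3_next !scaler0 add0r sub0r scale_scalar_mx.
by rewrite mulrN1 -raddfN opprK /= !mul_mx_scalar scaleN1r addrC.
Qed.

Lemma amx_vY_unit3 m :
  amx (m + 1) *m vY (unit3 m) = 3^-1 *: (vX (diff3 (m + 1)) + vY all1).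
Proof.
rewrite /amx /vX /vY mul_block_col !mulmx0 !add0r add_col_mx addr0 add0r scale_col_mx.
have DU : (diff3 (m + 1))^T *m unit3 m = (-1)%:M.
  by rewrite -[LHS]trmxK trmx_mul trmxK tr_unit3_diff3_next tr_scalar_mx.
by rewrite -!scalemxAl -!mulmxA DU !mul_mx_scalar !scaleN1r !scalerN !scaleNr !opprK.
Qed.

Lemma sum_Hmx_col (x y : 'cV[k]_3) :
  (Hmx (tperm letter1 letter2) + Hmx (tperm letter1 letter3) + Hmx (tperm letter2 letter3))
    *m col_mx x y = (\sum_i x i 0) *: vX all1 - (\sum_i y i 0) *: vY all1.
Proof.
have -> : Hmx (tperm letter1 letter2) + Hmx (tperm letter1 letter3)
    + Hmx (tperm letter2 letter3) = block_mx (const_mx 1) 0 0 (- const_mx 1).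
  (* For any letters [i] and [j], equal or not, exactly one transposition sends [i] to [j]. *)
  have E : perm_mx (tperm letter1 letter2) + perm_mx (tperm letter1 letter3)
      + perm_mx (tperm letter2 letter3) = const_mx 1 :> 'M[k]_3.
    by apply/matrixP => i j; rewrite !mxE !permE; elim/ord3P: i; elim/ord3P: j;
      rewrite /= ?addr0 ?add0r.
  by rewrite /Hmx !odd_tperm /= !expr1 !scaleN1r !add_block_mx -!opprD !addr0 E.
have J (z : 'cV_3) : (const_mx 1 : 'M[k]_3) *m z = (\sum_i z i 0) *: all1.
  apply/matrixP => i j; rewrite !mxE mulr1 ord1.
  by apply: eq_bigr => h _; rewrite mxE mul1r.
rewrite mul_block_col !mul0mx mulNmx !J addr0 add0r.
by rewrite /vX /vY !scale_col_mx opp_col_mx add_col_mx !scaler0 oppr0 addr0 add0r.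
Qed.

Lemma amx_vY_all1 m : amx m *m vY all1 = 0.
Proof.
rewrite /amx /vY mul_block_col !mulmx0 !add0r -!scalemxAl -!mulmxA tr_diff3_all1.
by rewrite !mulmx0 !scaler0 col_mx0.
Qed.

End Matrices.

(** * Generation by the invariants and indecomposability *)

Section Family.
Variables (k : fieldType) (l : k) (f : {lrmorphism A1 k -> 'M[k]_6}).
Hypothesis natr0 : forall n, (n%:R == 0 :> k) = (n == 0)%N.
Hypothesis fH : forall t, f (A1_H k t) = Hmx k t.
Hypothesis fa : forall i, f (A1_a k i) = transp_mx l i.

Local Notation u := (vX (all1 k)).
Local Notation s := (vY (all1 k)).
Local Notation d := (fun m => vX (diff3 k m)).

(* Omega acts on k^3 (+) sgn (x) k^3 as diag(J, -J), J the all-ones matrix, so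
   that its 3-eigenspace is the line of invariants. *)
Definition Omega : A1 k := A1_H k (tperm letter1 letter2)
  + A1_H k (tperm letter1 letter3) + A1_H k (tperm letter2 letter3).

Lemma rep_Omega (x y : 'cV[k]_3) :
  f Omega *m col_mx x y = (\sum_i x i 0) *: u - (\sum_i y i 0) *: s.
Proof. by rewrite -sum_Hmx_col /Omega 2!rmorphD /= !fH. Qed.

Lemma rep_Omega_u : f Omega *m u = 3 *: u.
Proof.
rewrite rep_Omega !big_ord_recl !big_ord0 !mxE !addr0 scale0r subr0.
by congr (_ *: _); ring.
Qed.

Lemma rep_Omega_d m : f Omega *m d m = 0.
Proof.
rewrite rep_Omega !big_ord_recl !big_ord0 !mxE !addr0 scale0r subr0 /eps.
by rewrite -[RHS](scale0r u); congr (_ *: _); elim/ord3P: m => /=; ring.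
Qed.

Lemma rep_Omega_s : f Omega *m s = - 3 *: s.
Proof.
rewrite rep_Omega !big_ord_recl !big_ord0 !mxE !addr0 scale0r sub0r scaleNr.
by congr (- (_ *: _)); ring.
Qed.

Let M : lmodType (A1 k) := mxmod f.

Lemma exists_rep_amx m : exists i, f (A1_a k i) = amx l m.
Proof.
elim/ord3P: m.
- by exists tau23; rewrite fa transp_mx23.
- by exists tau13; rewrite fa transp_mx13.
- by exists tau12; rewrite fa transp_mx12.
Qed.

Lemma submod_full (S : {pred M}) : submod_closed S -> (u : M) \in S -> forall v, v \in S.
Proof.
move=> [S0 SL] Su.
have SD (v w : M) : v \in S -> w \in S -> v + w \in S.
  by move=> vS wS; rewrite -[v]scale1r; apply: SL.
have Sf x (v : M) : v \in S -> (f x *m v : M) \in S.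
  by move=> vS; rewrite -mxmodE -[_ *: _]addr0; apply: SL.
have Sk (c : k) (v : M) : v \in S -> (c *: (v : 'cV_6) : M) \in S.
  by move=> vS; rewrite -mxmod_scalarE -[_ *: _]addr0; apply: SL.
have Sa m (v : M) : v \in S -> (amx l m *m v : M) \in S.
  by move=> vS; have [i <-] := exists_rep_amx m; apply: Sf.
have Sd m : (d m : M) \in S.
  (* Since [a_m u = 3 d_m + (3 l + 1) s], applying [Omega + 3], which kills [s] and is 3 on [d_m],
     leaves [9 d_m]. *)
  suff -> : d m = 9^-1 *: (f Omega *m (amx l m *m u) + 3 *: (amx l m *m u)).
    by apply/Sk/SD; [apply/Sf/Sa | apply/Sk/Sa].
  rewrite amx_vX_all1 mulmxDr -!scalemxAr rep_Omega_d rep_Omega_s scaler0 add0r.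
  rewrite !scalerDr !scalerA addrCA -scalerDl.
  have -> : 9^-1 * (3 * 3) = 1 :> k by field; rewrite natr0.
  have -> : 9^-1 * (3 * l + 1) * - 3 + 9^-1 * (3 * (3 * l + 1)) = 0.
    by field; rewrite natr0.
  by rewrite scale1r scale0r addr0.
have Ss : (s : M) \in S.
  (* Here [a_1 d_2 = 3 y_1 - s], and [a_2] sends this to [d_2 + s]. *)
  suff -> : s = amx l (letter1 + 1) *m (amx l letter1 *m d (letter1 + 1)) - d (letter1 + 1).
    by rewrite -scaleN1r; apply/SD/Sk/Sd; apply/Sa/Sa/Sd.
  rewrite amx_vX_diff3 mulmxBr amx_vY_all1 subr0 -scalemxAr amx_vY_unit3 scalerA.
  have -> : 3 * 3^-1 = 1 :> k by field; rewrite natr0.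
  by rewrite scale1r addrC addKr.
have Sy m : (vY (unit3 k m) : M) \in S.
  suff -> : vY (unit3 k m) = 3^-1 *: (amx l m *m d (m + 1) + s).
    by apply/Sk/SD => //; apply/Sa/Sd.
  rewrite amx_vX_diff3 subrK scalerA.
  have -> : 3^-1 * 3 = 1 :> k by field; rewrite natr0.
  by rewrite scale1r.
have Sx m : (vX (unit3 k m) : M) \in S.
  (* Both differences contain [x_m] with coefficient 1 after the signs, and the other two letters
     cancel against [u]. *)
  suff -> : vX (unit3 k m) = 3^-1 *: (u + d (m - 1) - d (m + 1)).
    by apply/Sk/SD; [apply: SD|rewrite -scaleN1r; apply: Sk].
  rewrite /vX opp_col_mx !add_col_mx scale_col_mx oppr0 !addr0 scaler0.
  congr col_mx; apply/matrixP => i j; rewrite !mxE /eps ord1.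
  by elim/ord3P: m; elim/ord3P: i => /=; field; rewrite natr0.
have Ssum (F : 'I_3 -> M) : (forall i, F i \in S) -> \sum_i F i \in S.
  by move=> SF; elim/big_ind: _.
have colE (x : 'cV[k]_3) : x = \sum_i x i 0 *: unit3 k i.
  rewrite {1}[x]matrix_sum_delta; apply: eq_bigr => i _.
  by rewrite big_ord_recl big_ord0 addr0.
move=> v; rewrite -[v](@vsubmxK _ 3 3 1); set x := usubmx _; set y := dsubmx _.
suff -> : col_mx x y = \sum_i x i 0 *: vX (unit3 k i) + \sum_i y i 0 *: vY (unit3 k i).
  by apply: SD; apply: Ssum => i; apply: Sk.
rewrite [in LHS](colE x) [in LHS](colE y).
have -> (x' y' : 'cV[k]_3) : col_mx x' y' = vX x' + vY y'.
  by rewrite /vX /vY add_col_mx addr0 add0r.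
by rewrite !linear_sum; congr (_ + _); apply: eq_bigr => i _; rewrite linearZ.
Qed.

(** The projection of [v] onto the invariant line is [wt v / 3] times [u]; the sign-twisted half has
    no invariants. *)
Definition wt (v : 'cV[k]_(3 + 3)) : k := \sum_i usubmx v i 0.

Lemma submod_full_wt (S : {pred M}) (v : M) : submod_closed S -> v \in S -> wt v != 0 ->
  forall v, v \in S.
Proof.
move=> Scl Sv wv; apply: submod_full => //.
case: (Scl) => [S0 SL].
(* [Omega] sends [v] into the span of [u] and [s], with coefficient [wt v] on [u]; then [Omega + 3]
   kills [s] and multiplies [u] by 6. *)
suff -> : (u : M) = ((6 * wt v)^-1)%:A *: (Omega *: (Omega *: v) + 3%:A *: (Omega *: v)).
  have SZ x (z : M) : z \in S -> x *: z \in S.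
    by move=> zS; rewrite -[x *: z]addr0; apply: SL.
  by apply/SZ; rewrite addrC; apply: SL; do ?apply/SZ.
rewrite !mxmod_scalarE !mxmodE.
suff: u = (6 * wt v)^-1 *: (f Omega *m (f Omega *m v) + 3 *: (f Omega *m v)) by [].
have -> : f Omega *m v = wt v *: u - (\sum_i (dsubmx (v : 'cV_(3 + 3))) i 0) *: s.
  by rewrite -rep_Omega vsubmxK.
set w' := \sum_i _.
rewrite mulmxBr -!scalemxAr rep_Omega_u rep_Omega_s scalerBr !scalerA mulrN scaleNr opprK.
rewrite (mulrC w') (mulrC (wt v)) addrACA subrr addr0 -scalerDl scalerA.
have -> : (6 * wt v)^-1 * (3 * wt v + 3 * wt v) = 1 by field; rewrite wv natr0.
by rewrite scale1r.
Qed.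

Lemma wtD v w : wt (v + w) = wt v + wt w.
Proof. by rewrite /wt -big_split; apply: eq_bigr => i _; rewrite !mxE. Qed.

Lemma wt_u : wt u = 3.
Proof. by rewrite /wt /vX col_mxKu !big_ord_recl big_ord0 !mxE; ring. Qed.

(** If [u = v + w] along a decomposition, then [wt v + wt w = 3], so one summand contains a vector
    of nonzero weight. That summand is the whole module, and the other is zero. *)
Lemma family_indecomposable : @indecomposable k (A1 k) M.
Proof.
split.
  exists (u : M); apply/eqP => u0.
  have := wt_u; rewrite u0 /wt big1 => [|i _]; last by rewrite !mxE.
  by move/eqP; rewrite eq_sym natr0.
move=> S T Scl Tcl ST ST0.
have [v [w [Sv Tw vw]]] := ST (u : M).
have : wt v + wt w != 0 by rewrite -wtD -[_ + _]vw wt_u natr0.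
have [wv0|wv0 _] := eqVneq (wt v) 0.
  by rewrite wv0 add0r => ww0; left=> x Sx; apply: ST0 => //; apply: submod_full_wt Tw _ _.
by right=> x Tx; apply: ST0 => //; apply: submod_full_wt Sv _ _.
Qed.

(** * Recovering the parameter from the isomorphism class *)

Lemma Omega_eigen (w : M) :
  Omega *: w = 3%:A *: w -> exists c : k, w = (c *: u : 'cV_(3 + 3)).
Proof.
rewrite mxmodE mxmod_scalarE -[w](@vsubmxK _ 3 3 1) rep_Omega.
set x := usubmx _; set y := dsubmx _; set a := \sum_i x i 0; set b := \sum_i y i 0.
rewrite /vX /vY !scale_col_mx !scaler0 opp_col_mx add_col_mx oppr0 addr0 add0r.
move=> E; have {E}/eq_col_mx[Ex Ey] : col_mx (a *: all1 k) (- (b *: all1 k))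
    = col_mx (3 *: x) (3 *: y) by rewrite -scale_col_mx; exact: E.
exists (3^-1 * a).
have three_neq0 : 3 != 0 :> k by rewrite natr0.
(* The lower half reads [- b = 3 y_i] for every [i]; summing gives [- 3 b = 3 b]. *)
have b0 : b = 0.
  have : \sum_i (3 *: y) i 0 = 3 * b.
    by rewrite mulr_sumr; apply: eq_bigr => i _; rewrite mxE.
  rewrite -Ey !big_ord_recl big_ord0 !mxE => E.
  have /eqP : 6 * b = 0 by transitivity (3 * b + 3 * b); [|rewrite -{1}E]; ring.
  by rewrite mulf_eq0 natr0 => /eqP.
have -> : y = 0 by apply: (scalerI three_neq0); rewrite -Ey b0 scale0r oppr0 scaler0.
have -> : x = (3^-1 * a) *: all1 k.
  by apply: (scalerI three_neq0); rewrite -Ex !scalerA mulrA divff // mul1r.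
by rewrite scale_col_mx scaler0.
Qed.

(** On [u], the factor [Omega + 3] strips the part of [a_3 u] that depends on [l] and leaves
    [9 d_3]; then [a_3 a_2 - 1] turns [d_3] into [s]. *)
Definition socle_elt : A1 k :=
  (A1_a k tau12 * A1_a k tau13 - 1) * (Omega + 3%:A) * A1_a k tau12.
Definition param_elt : A1 k := Omega * A1_a k tau12.

Lemma rep_param_elt : f param_elt *m u = (- 3 * (3 * l + 1)) *: s.
Proof.
rewrite /param_elt rmorphM -mulmxA /= fa transp_mx12 amx_vX_all1 mulmxDr -!scalemxAr.
by rewrite rep_Omega_d rep_Omega_s scaler0 add0r scalerA mulrC.
Qed.

Lemma rep_socle_elt : f socle_elt *m u = 9 *: s.
Proof.
have fO m c : f (Omega + 3%:A) *m (3 *: d m + c *: s) = 9 *: d m.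
  rewrite rmorphD /= linearZ /= rmorph1 mulmxDl -scalemxAl mul1mx mulmxDr -!scalemxAr.
  rewrite rep_Omega_d rep_Omega_s scaler0 add0r scalerDr !scalerA mulrN (mulrC c) scaleNr.
  by rewrite addrC addrK; congr (_ *: _); ring.
have e3 : letter3 = letter2 + 1 by apply: val_inj.
rewrite /socle_elt rmorphM -mulmxA /= fa transp_mx12 amx_vX_all1 rmorphM -mulmxA fO.
rewrite /= rmorphB rmorphM rmorph1 /= !fa transp_mx12 transp_mx13.
rewrite -scalemxAr mulmxBl mul1mx -mulmxA e3 amx_vX_diff3 mulmxBr amx_vY_all1 subr0.
rewrite -scalemxAr amx_vY_unit3.
have n3 : 3 != 0 :> k by rewrite natr0.
by rewrite scalerA divff // scale1r (addrC (d _)) addrK.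
Qed.

End Family.

Lemma family_iso_inj (k : fieldType) (l l' : k) (f f' : {lrmorphism A1 k -> 'M[k]_6})
    (N : lmodType (A1 k)) :
  (forall n, (n%:R == 0 :> k) = (n == 0)%N) ->
  (forall t, f (A1_H k t) = Hmx k t) -> (forall i, f (A1_a k i) = transp_mx l i) ->
  (forall t, f' (A1_H k t) = Hmx k t) -> (forall i, f' (A1_a k i) = transp_mx l' i) ->
  isomorphic (mxmod f) N -> isomorphic (mxmod f') N -> l = l'.
Proof.
move=> natr0 fH fa f'H f'a [g /bij_inj g_inj] [g' [h hK g'K]].
pose u : mxmod f := vX (all1 k).
have u0 : u <> 0.
  move=> uE; have := wt_u k; rewrite -/u uE /wt big1 => [/eqP|i _]; last by rewrite !mxE.
  by rewrite eq_sym natr0.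
(* [h] is only a set-theoretic inverse of [g'], so identities about [h (g u)] are tested after
   applying the injective linear map [g']. The image of [u] is again a 3-eigenvector of [Omega]. *)
have [c cE] : exists c : k, h (g u) = (c *: (vX (all1 k)) : 'cV_(3 + 3)).
  apply: (Omega_eigen natr0 f'H); apply: (can_inj hK).
  rewrite !linearZ !g'K -!linearZ; congr (g _).
  by rewrite mxmodE mxmod_scalarE (rep_Omega_u fH).
have c0 : c != 0.
  apply: contra_not_neq u0 => c0; apply: g_inj; rewrite -[g u]g'K cE c0 scale0r.
  by rewrite !raddf0.
have X_eq0 (x : A1 k) : f x *m vX (all1 k) = 0 -> f' x *m vX (all1 k) = 0.
  move=> xu0.
  have : x *: h (g u) = 0.
    by apply: (can_inj hK); rewrite linearZ g'K -linearZ mxmodE xu0 !raddf0.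
  rewrite mxmodE cE -scalemxAr => /eqP.
  by rewrite scaler_eq0 (negPf c0) => /eqP.
(* This combination is chosen to kill [u] for the parameter [l]; for [l'] it gives
   [27 (l - l') s]. *)
have := X_eq0 (3 *: param_elt k + (3 * l + 1) *: socle_elt k).
rewrite !linearD /= !linearZ /= !mulmxDl -!scalemxAl.
rewrite (rep_socle_elt natr0 fH fa) (rep_param_elt fH fa).
rewrite (rep_socle_elt natr0 f'H f'a) (rep_param_elt f'H f'a).
rewrite !scalerA -!scalerDl.
have -> : 3 * (- 3 * (3 * l + 1)) + (3 * l + 1) * 9 = 0 by ring.
have -> : 3 * (- 3 * (3 * l' + 1)) + (3 * l + 1) * 9 = 27 * (l - l') by ring.
rewrite scale0r => /(_ erefl)/(congr1 (fun v : 'cV_(3 + 3) => dsubmx v letter1 0)).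
rewrite /vY linearZ /= col_mxKd !mxE mulr1 => /eqP.
by rewrite mulf_eq0 natr0 /= subr_eq0 => /eqP.
Qed.

(** * Infinitely many isomorphism classes, by pigeonhole *)

Theorem proposition5p16 (k : closedFieldType) (k_char0 : [pchar k] =i pred0) :
  ~ finite_representation_type (A1 k).
Proof.
have /pcharf0P natr0 := k_char0.
move=> [n [N [_ complete]]].
have three_neq0 : 3 != 0 :> k by rewrite natr0.
(* A list of [n] modules is tested on the [n + 1] parameters [0, ..., n], which are distinct in [k]
   by characteristic zero. *)
have /fin_all_exists[i_ iP] (j : 'I_n.+1) : exists i,
    exists f : {lrmorphism A1 k -> 'M[k]_6},
    [/\ forall t, f (A1_H k t) = Hmx k t, forall i, f (A1_a k i) = transp_mx j%:R i
      & isomorphic (mxmod f) (N i)].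
  have [f [fH fa]] := A1_rep_exists (j%:R) three_neq0.
  have [i iso] := complete (mxmod f) (mxmod_finite_dimensional f)
    (family_indecomposable natr0 fH fa).
  by exists i, f.
have i_inj : injective i_.
  move=> j j' jj'; apply: val_inj => /=.
  have [f [fH fa iso]] := iP j; have [f' [f'H f'a iso']] := iP j'.
  rewrite -jj' in iso'.
  exact/(natr_inj natr0)/(family_iso_inj natr0 fH fa f'H f'a iso iso').
by have := leq_card i_ i_inj; rewrite !card_ord ltnn.
Qed.
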